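(* Let $p_1,p_2,\ldots\in[0,1]$. For each $d\ge 1$, let $Q_d$ be the probability that a random subset of the vertices of $T_d$ is decodable, where each vertex of layer $i$ ($1\le i\le d$) is included in the subset with probability $p_i$, independently of all other vertices. Then $Q_1=p_1$ and, for every $d>1$, $$Q_d=Q_{d-1}^2+2^{d-1}p_d\prod_{i=1}^{d-1}\left[(1-p_i)Q_i\right].$$
   Context: $T_d$ is the perfect binary tree with $d$ layers and $2^d-1$ vertices; layers are numbered from the leaves (layer $1$) to the root (layer $d$), so layer $i$ has $2^{d-i}$ vertices. The $2^{d-1}$ leaves carry the data fragments (binary vectors of a fixed length). Every non-leaf vertex carries the bitwise XOR of the fragments of its two children. A subset of the vertices of $T_d$ is decodable if the fragments at its vertices determine all $2^{d-1}$ data fragments (equivalently, the indicator vectors over $\mathbb{F}_2$ of the leaf sets below its vertices span $\mathbb{F}_2^{2^{d-1}}$). *)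

(* Defs.v *)
From mathcomp Require Import all_boot all_order all_algebra.

Set Implicit Arguments.
Unset Strict Implicit.
Unset Printing Implicit Defensive.

Import GRing.Theory.
Local Open Scope ring_scope.

(* Perfect binary trees always have at least one layer, so they are indexed by
   their height: [vertex n] and [leaf n] are the vertices and the leaves of the
   tree T_(n+1) with n.+1 layers.  In [vertex m.+1], [None] is the root and
   [Some (inl u)], [Some (inr u)] are the vertices of the two subtrees. *)
Fixpoint vertex (n : nat) : finType :=
  if n is m.+1 then option (vertex m + vertex m)%type else unit.

Fixpoint leaf (n : nat) : finType :=
  if n is m.+1 then (leaf m + leaf m)%type else unit.

Definition root_vertex (n : nat) : vertex n :=
  match n return vertex n with
  | 0 => tt
  | m.+1 => None
  end.

(* Layers are counted from 1 (the leaves) to n.+1 (the root). *)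
Fixpoint layer (n : nat) : vertex n -> nat :=
  match n return vertex n -> nat with
  | 0 => fun=> 1%N
  | m.+1 => fun v : option (vertex m + vertex m) =>
      match v with
      | None => m.+2
      | Some (inl u) => layer u
      | Some (inr u) => layer u
      end
  end.

(* Binary vectors of length l are row vectors over 'F_2, so that bitwise XOR is
   the addition. *)
Fixpoint fragment (l n : nat) :
    (leaf n -> 'rV['F_2]_l) -> vertex n -> 'rV['F_2]_l :=
  match n return (leaf n -> 'rV['F_2]_l) -> vertex n -> 'rV['F_2]_l with
  | 0 => fun x _ => x tt
  | m.+1 => fun (x : leaf m + leaf m -> 'rV['F_2]_l)
                (v : option (vertex m + vertex m)) =>
      match v with
      | None => fragment (fun a => x (inl a)) (root_vertex m)
                + fragment (fun a => x (inr a)) (root_vertex m)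
      | Some (inl u) => fragment (fun a => x (inl a)) u
      | Some (inr u) => fragment (fun a => x (inr a)) u
      end
  end.

Definition decodable (l n : nat) (S : {set vertex n}) : bool :=
  [forall x : {ffun leaf n -> 'rV['F_2]_l},
   forall y : {ffun leaf n -> 'rV['F_2]_l},
     [forall v in S, fragment x v == fragment y v] ==> (x == y)].

(* Probability that the random subset is exactly S, when the vertices are
   included independently, those of layer i with probability p i. *)
Definition subset_prob (R : pzRingType) (p : nat -> R) (n : nat)
    (S : {set vertex n}) : R :=
  \prod_(v : vertex n) (if v \in S then p (layer v) else 1 - p (layer v)).

(* Q_d for d >= 1, with fragments of length l; the value at d = 0 is junk
   (there is no tree without layers). *)
Definition Q (R : pzRingType) (l : nat) (p : nat -> R) (d : nat) : R :=
  \sum_(S : {set vertex d.-1} | decodable l S) subset_prob p S.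

(* Main.v *)
Require Import Defs.
From mathcomp Require Import all_boot all_order all_algebra.
From mathcomp Require Import ring.

(* Let [K] be the space of labellings of the leaves that vanish on [S].  Call
   [S] decodable if [K = 0], and nearly decodable if the fragment of the root
   is an isomorphism on [K], i.e. only the value at the root is missing.  If S1
   and S2 are the traces of S on the two subtrees, S is decodable iff both
   traces are, or one is and the other is nearly decodable while S contains the
   root; S is nearly decodable iff one trace is decodable, the other nearly
   decodable, and S misses the root.  Independence turns this into
   Q_(d+1) = Q_d^2 + 2 p_(d+1) Q_d U_d and U_(d+1) = 2 (1 - p_(d+1)) Q_d U_d for
   the probability U_d of being nearly decodable, and U_1 = 1 - p_1. *)

Set Implicit Arguments.
Unset Strict Implicit.
Unset Printing Implicit Defensive.

Import Order.TTheory GRing.Theory Num.Theory.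
Local Open Scope ring_scope.

(** * Vertex sets as a root bit and two traces *)

Definition left_part m (S : {set vertex m.+1}) : {set vertex m} :=
  [set u | (Some (inl u) : vertex m.+1) \in S].

Definition right_part m (S : {set vertex m.+1}) : {set vertex m} :=
  [set u | (Some (inr u) : vertex m.+1) \in S].

Definition join_parts m (b : bool) (S1 S2 : {set vertex m}) :
    {set vertex m.+1} :=
  [set v : vertex m.+1 | match v : option (vertex m + vertex m) with
                         | None => b
                         | Some (inl u) => u \in S1
                         | Some (inr u) => u \in S2
                         end].

Lemma left_part_join m b (S1 S2 : {set vertex m}) :
  left_part (join_parts b S1 S2) = S1.
Proof. by apply/setP => u; rewrite !inE. Qed.

Lemma right_part_join m b (S1 S2 : {set vertex m}) :
  right_part (join_parts b S1 S2) = S2.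
Proof. by apply/setP => u; rewrite !inE. Qed.

Lemma root_in_join m b (S1 S2 : {set vertex m}) :
  (root_vertex m.+1 \in join_parts b S1 S2) = b.
Proof. by rewrite inE. Qed.

Lemma join_partsK m (S : {set vertex m.+1}) :
  join_parts (root_vertex m.+1 \in S) (left_part S) (right_part S) = S.
Proof. by apply/setP => -[[u|u]|]; rewrite !inE. Qed.

(* [defect S] is 0 if [S] is decodable, 1 if it is nearly decodable, and at
   least 2 otherwise. *)
Fixpoint defect n : {set vertex n} -> nat :=
  match n return {set vertex n} -> nat with
  | 0 => fun S => (tt : vertex 0) \notin S
  | m.+1 => fun S =>
      let k := (defect (left_part S) + defect (right_part S))%N in
      (k - ((root_vertex m.+1 \in S) && (k == 1)))%N
  end.

(** * Linear algebra: decodability read off from the defect *)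

Section Kernel.
Variable l : nat.
Implicit Type n : nat.

Definition vanishes n (S : {set vertex n}) (x : leaf n -> 'rV['F_2]_l) :=
  forall v, v \in S -> fragment x v = 0.

Lemma eq_fragment n (x y : leaf n -> 'rV['F_2]_l) :
  x =1 y -> fragment x =1 fragment y.
Proof.
elim: n x y => [|m IH] x y xy v /=; first exact: xy.
have Hl := IH (fun a => x (inl a)) _ (fun a => xy (inl a)).
have Hr := IH (fun a => x (inr a)) _ (fun a => xy (inr a)).
by case: v => [[u|u]|]; rewrite ?Hl ?Hr.
Qed.

Lemma fragmentB n (x y : leaf n -> 'rV['F_2]_l) v :
  fragment (fun a => x a - y a) v = fragment x v - fragment y v.
Proof.
elim: n x y v => [//|m IH] x y [[u|u]|] /=.
- exact: (IH (fun a => x (inl a)) (fun a => y (inl a))).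
- exact: (IH (fun a => x (inr a)) (fun a => y (inr a))).
rewrite (IH (fun a => x (inl a)) (fun a => y (inl a))).
by rewrite (IH (fun a => x (inr a)) (fun a => y (inr a))) opprD addrACA.
Qed.

Lemma fragment0 n (v : vertex n) : fragment (fun=> 0 : 'rV['F_2]_l) v = 0.
Proof. by elim: n v => [//|m IH] [[u|u]|] /=; rewrite ?IH ?addr0. Qed.

(** Fragments are additive in the labelling, so injectivity reduces to a trivial kernel: compare
    with the zero labelling in one direction, take [x - y] in the other. *)
Lemma decodableP n (S : {set vertex n}) :
  reflect (forall x : leaf n -> 'rV['F_2]_l, vanishes S x -> forall a, x a = 0)
          (decodable l S).
Proof.
apply: (iffP forallP) => [dS x Sx a|dS x].
  have /forallP/(_ 0)/implyP := dS [ffun a => x a].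
  suff /[swap]/[apply]/eqP/ffunP/(_ a) :
      [forall v in S, fragment [ffun a => x a] v
         == fragment (0 : {ffun leaf n -> 'rV['F_2]_l}) v].
    by rewrite !ffunE.
  apply/forall_inP => v vS.
  rewrite (eq_fragment (ffunE x)) Sx //.
  by rewrite (eq_fragment (y := fun=> 0)) ?fragment0 // => b; rewrite ffunE.
apply/forallP => y; apply/implyP => /forall_inP xy; apply/eqP/ffunP => a.
apply/eqP; rewrite -subr_eq0; apply/eqP.
apply: (dS (fun a => x a - y a)) => v vS.
by rewrite fragmentB (eqP (xy v vS)) subrr.
Qed.

Definition join_leaves m (x y : leaf m -> 'rV['F_2]_l) :
    leaf m.+1 -> 'rV['F_2]_l :=
  fun a => match a : leaf m + leaf m with inl b => x b | inr b => y b end.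

Lemma vanishes_split m (S : {set vertex m.+1}) (x : leaf m.+1 -> 'rV['F_2]_l) :
  vanishes S x <->
  [/\ vanishes (left_part S) (fun a => x (inl a)),
      vanishes (right_part S) (fun a => x (inr a)) &
      root_vertex m.+1 \in S -> fragment x (root_vertex m.+1) = 0].
Proof.
split=> [Sx | [S1 S2 Sr]].
  by split=> [u|u|]; rewrite ?inE => /Sx.
by case=> [[u|u]|] uS; [apply: S1 | apply: S2 | apply: Sr]; rewrite ?inE.
Qed.

Lemma vanishes0 n (S : {set vertex n}) : vanishes S (fun=> 0).
Proof. by move=> v _; apply: fragment0. Qed.

(** Both cases must be proved together: when one trace is decodable and the other nearly so, the
    first half of [x] is zero, hence the root value of the second half equals that of the whole
    tree, which is zero. *)
Lemma defect0_inj n (S : {set vertex n}) (x : leaf n -> 'rV['F_2]_l) :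
    vanishes S x ->
    (defect S == 0%N) ||
      (defect S == 1%N) && (fragment x (root_vertex n) == 0) ->
  forall a, x a = 0.
Proof.
elim: n S x => [|m IH] S x Sx.
  rewrite /=; case: (boolP (tt \in _)) => [tS _ []|_ /eqP x0 []] //.
  exact: (Sx tt).
have [S1 S2 Sr] := (vanishes_split S x).1 Sx.
have {}IH1 := IH _ _ S1; have {}IH2 := IH _ _ S2.
move=> dS.
(* The root value is zero because [S] contains the root or, if it does not, because the defect is 1
   and [dS] supplies it. *)
have {Sr} Sr: (defect (left_part S) + defect (right_part S) == 1)%N ->
    fragment x (root_vertex m.+1) = 0.
  move: dS => /=; case: (root_vertex _ \in S) Sr => /= [->//|_ + d1].
  by rewrite subn0 (eqP d1) /= => /eqP.
(* The root lowers the sum of defects only from 1 to 0, so a defect of at most 1 forces a sum of at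
   most 1. *)
have : (defect (left_part S) == 0%N) && (defect (right_part S) == 0%N)
   || (defect (left_part S) == 0%N) && (defect (right_part S) == 1%N)
   || (defect (left_part S) == 1%N) && (defect (right_part S) == 0%N).
  move: dS => /=.
  by case: (defect _) => [|[|i]]; case: (defect _) => [|[|j]];
     case: (_ \in _); rewrite ?addnS ?addSn ?subSS ?subn0.
case/orP => [/orP[]|] /andP[d1 d2].
- by case=> a; [apply: IH1; rewrite d1 | apply: IH2; rewrite d2].
- have x1 a : x (inl a) = 0 by apply: IH1; rewrite d1.
  case=> a; [exact: x1 | apply: IH2].
  move: Sr; rewrite (eqP d1) (eqP d2) => /(_ isT) /=.
  by rewrite (eq_fragment x1) fragment0 add0r => ->; rewrite eqxx.
- have x2 a : x (inr a) = 0 by apply: IH2; rewrite d2.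
  case=> a; [apply: IH1 | exact: x2].
  move: Sr; rewrite (eqP d1) (eqP d2) => /(_ isT) /=.
  by rewrite (eq_fragment x2) fragment0 addr0 => ->; rewrite eqxx.
Qed.

(** The value [c] is realised in the nearly decodable subtree and the other subtree is filled with
    zeros; the root is not in [S], so it imposes no constraint. *)
Lemma defect1_surj n (S : {set vertex n}) (c : 'rV['F_2]_l) :
  defect S = 1%N ->
  exists2 x, vanishes S x & fragment x (root_vertex n) = c.
Proof.
elim: n S => [|m IH] S /=.
  case: (boolP (tt \in _)) => // tS _.
  by exists (fun=> c) => // -[]; rewrite (negPf tS).
move=> dS.
(* With the root in [S], a sum of 1 would have dropped to 0. *)
have [rS d12] : root_vertex m.+1 \notin S /\
    (defect (left_part S) + defect (right_part S) = 1)%N.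
  move: dS; set k := (_ + _)%N; case: (_ \in S) => /=; last by rewrite subn0.
  by case: k => [|[|[|k]]].
have [[d1 d2]|[d1 d2]] :
   (defect (left_part S) = 0%N /\ defect (right_part S) = 1%N)
   \/ (defect (left_part S) = 1%N /\ defect (right_part S) = 0%N).
- by move: d12; case: (defect _) => [|[|i]]; case: (defect _) => [|[|j]] //= _;
    [left|right].
- have [x Sx xc] := IH _ d2; exists (join_leaves (fun=> 0) x).
    by apply/vanishes_split; split=> //; [exact: vanishes0|rewrite (negPf rS)].
  by rewrite /= fragment0 add0r.
- have [x Sx xc] := IH _ d1; exists (join_leaves x (fun=> 0)).
    by apply/vanishes_split; split=> //; [exact: vanishes0|rewrite (negPf rS)].
  by rewrite /= fragment0 addr0.
Qed.

Hypothesis hl : (0 < l)%N.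

(** Positive length matters here: with fragments of length 0 every vertex set would be decodable. *)
Lemma exists_rV_neq0 : exists c : 'rV['F_2]_l, c != 0.
Proof.
exists (const_mx 1); apply/eqP => /rowP/(_ (Ordinal hl)).
by rewrite !mxE => /eqP; rewrite oner_eq0.
Qed.

(** Asking for a zero root value strengthens the induction: such a labelling of one subtree,
    extended by zero, still vanishes on [S] even if [S] contains the new root. *)
Lemma defect_ge2_kernel n (S : {set vertex n}) :
  (1 < defect S)%N ->
  exists x : leaf n -> 'rV['F_2]_l,
    [/\ vanishes S x, fragment x (root_vertex n) = 0 & exists a, x a != 0].
Proof.
elim: n S => [|m IH] S /=; first by case: (_ \in _).
move=> dS.
have [d1|d2|[d1 d2]] : [\/ (1 < defect (left_part S))%N,
   (1 < defect (right_part S))%N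
   | defect (left_part S) = 1%N /\ defect (right_part S) = 1%N].
- move: dS; case: (defect _) => [|[|i]]; case: (defect _) => [|[|j]] //;
    case: (_ \in S) => //= _;
    by [apply: Or31 | apply: Or32 | apply: Or33].
- have [x [Sx rx [a xa]]] := IH _ d1; exists (join_leaves x (fun=> 0)).
  have r0 : fragment (join_leaves x (fun=> 0)) (root_vertex m.+1) = 0.
    by rewrite /= rx fragment0 addr0.
  split=> //; last by exists (inl a).
  by apply/vanishes_split; split=> //; exact: vanishes0.
- have [x [Sx rx [a xa]]] := IH _ d2; exists (join_leaves (fun=> 0) x).
  have r0 : fragment (join_leaves (fun=> 0) x) (root_vertex m.+1) = 0.
    by rewrite /= rx fragment0 addr0.
  split=> //; last by exists (inr a).
  by apply/vanishes_split; split=> //; exact: vanishes0.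
(* Both traces are nearly decodable: root values [c] and [- c] in the two halves cancel at the
   common root. *)
have [c c0] := exists_rV_neq0.
have [x Sx rx] := defect1_surj c d1; have [y Sy ry] := defect1_surj (- c) d2.
have r0 : fragment (join_leaves x y) (root_vertex m.+1) = 0.
  by rewrite /= rx ry subrr.
exists (join_leaves x y); split=> //; first by apply/vanishes_split.
(* The labelling [x] is nonzero at some leaf, since its root value is [c]. *)
have [/existsP[a xa]|/existsPn x0] := boolP [exists a, x a != 0].
  by exists (inl a).
have {}x0 a : x a = 0 by apply/eqP; rewrite -[_ == _]negbK x0.
by case/eqP: c0; rewrite -rx (eq_fragment x0) fragment0.
Qed.

Lemma decodableE n (S : {set vertex n}) : decodable l S = (defect S == 0%N).
Proof.
apply/decodableP/idP => [dS|dS x Sx]; last first.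
  by apply: (defect0_inj Sx); rewrite dS.
case d: (defect S) => [//|[|k]].
  have [c /eqP c0] := exists_rV_neq0.
  have [x Sx rx] := defect1_surj c d.
  by case: c0; rewrite -rx (eq_fragment (dS x Sx)) fragment0.
have [|x [Sx _ [a /eqP[]]]] := @defect_ge2_kernel n S; first by rewrite d.
exact: dS.
Qed.

End Kernel.

(** * Probability: independence and the recursions *)

Lemma prod_option (R : comPzRingType) (T : finType) (F : option T -> R) :
  \prod_v F v = F None * \prod_u F (Some u).
Proof.
rewrite (bigD1 None) //=; congr (_ * _).
rewrite (reindex_omap Some id) => [|[]] //=.
by apply: eq_bigl => u; rewrite eqxx.
Qed.

Section Probability.
Variables (R : comPzRingType) (p : nat -> R).

Definition expectation n (f : {set vertex n} -> R) : R :=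
  \sum_S subset_prob p S * f S.

(** Layers are counted from the leaves, so a vertex of a subtree keeps its layer in the whole tree
    and the same [p] serves both. *)
Lemma subset_prob_join m b (S1 S2 : {set vertex m}) :
  subset_prob p (join_parts b S1 S2) =
  (if b then p m.+2 else 1 - p m.+2) * (subset_prob p S1 * subset_prob p S2).
Proof.
rewrite /subset_prob /= prod_option big_sumType /= inE.
by congr (_ * (_ * _)); apply: eq_bigr => u _; rewrite inE.
Qed.

(** Conditioning on the root: the sum is reindexed by the bijection between vertex sets and triples
    of a root bit and two traces. *)
Lemma expectation_join m (f : {set vertex m.+1} -> R) :
  expectation f =
  p m.+2 * expectation (fun S1 =>
             expectation (fun S2 => f (join_parts true S1 S2)))
  + (1 - p m.+2) * expectation (fun S1 =>
             expectation (fun S2 => f (join_parts false S1 S2))).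
Proof.
rewrite /expectation.
pose g (t : bool * ({set vertex m} * {set vertex m})) :=
  join_parts t.1 t.2.1 t.2.2.
pose h (S : {set vertex m.+1}) :=
  (root_vertex m.+1 \in S, (left_part S, right_part S)).
have gK : cancel g h.
  by case=> b [S1 S2]; rewrite /h root_in_join left_part_join right_part_join.
have hK : cancel h g by move=> S; apply: join_partsK.
rewrite (reindex g) /=; last by exists h => ? _.
rewrite -(pair_bigA _ (fun b t => subset_prob p (g (b, t)) * f (g (b, t)))) /=.
rewrite big_bool /= !mulr_sumr.
pose F b S1 S2 := subset_prob p (g (b, (S1, S2))) * f (g (b, (S1, S2))).
rewrite -(pair_bigA _ (F true)) -(pair_bigA _ (F false)) /F.
by congr (_ + _); apply: eq_bigr => S1 _; rewrite !mulr_sumr;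
  apply: eq_bigr => S2 _; rewrite subset_prob_join /= !mulrA.
Qed.

(** The tree here has [n.+1] layers: [k = 0] gives $Q_{n+1}$ and [k = 1] gives $U_{n+1}$. *)
Definition defect_prob n k : R :=
  expectation (fun S : {set vertex n} => (defect S == k)%:R).

Lemma expectationM n (f g : {set vertex n} -> R) :
  expectation (fun S1 => expectation (fun S2 => f S1 * g S2)) =
  expectation f * expectation g.
Proof.
rewrite /expectation mulr_suml; apply: eq_bigr => S1 _.
rewrite -mulrA; congr (_ * _); rewrite !mulr_sumr.
by apply: eq_bigr => S2 _; rewrite mulrCA.
Qed.

Lemma expectationD n (f g : {set vertex n} -> R) :
  expectation (fun S => f S + g S) = expectation f + expectation g.
Proof. by rewrite -big_split; apply: eq_bigr => S _; rewrite mulrDr. Qed.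

Lemma eq_expectation n (f g : {set vertex n} -> R) :
  f =1 g -> expectation f = expectation g.
Proof. by move=> fg; apply: eq_bigr => S _; rewrite fg. Qed.

Lemma expectation2D m (F G : {set vertex m} -> {set vertex m} -> R) :
  expectation (fun S1 => expectation (fun S2 => F S1 S2 + G S1 S2)) =
  expectation (fun S1 => expectation (F S1))
  + expectation (fun S1 => expectation (G S1)).
Proof.
by rewrite -expectationD; apply: eq_expectation => S; rewrite expectationD.
Qed.

Lemma expectation0 n : expectation (fun _ : {set vertex n} => 0) = 0.
Proof. by apply: big1 => S _; rewrite mulr0. Qed.

Lemma defect_join m b (S1 S2 : {set vertex m}) :
  defect (join_parts b S1 S2) =
  (defect S1 + defect S2 - (b && (defect S1 + defect S2 == 1%N)))%N.
Proof. by rewrite /= left_part_join right_part_join root_in_join. Qed.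

Lemma defect0_prob_rec m :
  defect_prob m.+1 0 = defect_prob m 0 ^+ 2
    + p m.+2 * (defect_prob m 0 * defect_prob m 1 *+ 2).
Proof.
pose I k (S : {set vertex m}) : R := (defect S == k)%:R.
rewrite /defect_prob expectation_join.
(* With the root present, defect 0 arises exactly from the pairs (0,0), (0,1) and (1,0). *)
have -> : expectation (fun S1 : {set vertex m} => expectation (fun S2 =>
     (defect (join_parts true S1 S2) == 0%N)%:R)) =
  expectation (fun S1 => expectation (fun S2 =>
     I 0 S1 * I 0 S2 + (I 0 S1 * I 1 S2 + I 1 S1 * I 0 S2))).
  apply: eq_expectation => S1; apply: eq_expectation => S2.
  rewrite defect_join /I.
  by case: (defect _) => [|[|i]]; case: (defect _) => [|[|j]];
    rewrite ?addnS ?addSn /= ?subSS ?subn0 ?(mul0r, mulr0, mul1r, addr0, add0r).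
have -> : expectation (fun S1 : {set vertex m} => expectation (fun S2 =>
     (defect (join_parts false S1 S2) == 0%N)%:R)) =
  expectation (fun S1 => expectation (fun S2 => I 0 S1 * I 0 S2)).
  apply: eq_expectation => S1; apply: eq_expectation => S2.
  by rewrite defect_join subn0 addn_eq0 /I -natrM mulnb.
rewrite !expectation2D !expectationM.
by rewrite -/(defect_prob _ _); ring.
Qed.

Lemma defect1_prob_rec m :
  defect_prob m.+1 1 =
  (1 - p m.+2) * (defect_prob m 0 * defect_prob m 1 *+ 2).
Proof.
pose I k (S : {set vertex m}) : R := (defect S == k)%:R.
rewrite /defect_prob expectation_join.
(* With the root present, the sums 0 and 1 both give defect 0 and larger sums stay put, so 1 is
   never attained. *)
have -> : expectation (fun S1 : {set vertex m} => expectation (fun S2 =>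
     (defect (join_parts true S1 S2) == 1%N)%:R)) = 0.
  rewrite -[RHS](expectation0 m); apply: eq_expectation => S1.
  rewrite -[RHS](expectation0 m); apply: eq_expectation => S2.
  rewrite defect_join.
  by case: (_ + _)%N => [|[|i]].
have -> : expectation (fun S1 : {set vertex m} => expectation (fun S2 =>
     (defect (join_parts false S1 S2) == 1%N)%:R)) =
  expectation (fun S1 => expectation (fun S2 =>
    I 0 S1 * I 1 S2 + I 1 S1 * I 0 S2)).
  apply: eq_expectation => S1; apply: eq_expectation => S2.
  rewrite defect_join subn0 /I.
  by case: (defect _) => [|[|i]]; case: (defect _) => [|[|j]];
    rewrite ?addnS ?addSn /= ?(mul0r, mulr0, mul1r, addr0, add0r).
rewrite !expectation2D !expectationM.
by rewrite -/(defect_prob _ _); ring.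
Qed.

Lemma expectation_vertex0 (f : {set vertex 0} -> R) :
  expectation f = p 1%N * f setT + (1 - p 1%N) * f set0.
Proof.
rewrite /expectation (bigD1 setT) //= (bigD1 set0) /=; last first.
  by apply/eqP => /setP/(_ tt); rewrite !inE.
rewrite big1 ?addr0 => [|S /andP[/eqP ST /eqP S0]].
  have prod_unit (F : unit -> R) : \prod_v F v = F tt.
    by rewrite (big_pred1 tt) // => -[].
  by rewrite /subset_prob !prod_unit !inE.
case: (boolP (tt \in (S : {set vertex 0}))) => tS.
  by case: ST; apply/setP => -[]; rewrite inE.
by case: S0; apply/setP => -[]; rewrite inE (negPf tS).
Qed.

(** The quantity $2 Q_d U_d$ occurs in both recursions, and passing from $d$ to $d+1$ multiplies it
    by $2 (1 - p_{d+1}) Q_{d+1}$, so it unrolls to a product. *)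
Lemma defect1_prob_closed n :
  defect_prob n 0 * defect_prob n 1 *+ 2 =
  (2 ^ n.+1)%N%:R * \prod_(0 <= i < n.+1) ((1 - p i.+1) * defect_prob i 0).
Proof.
elim: n => [|n IH].
  rewrite big_nat1 {2}/defect_prob expectation_vertex0 /= !inE /=.
  by ring.
by rewrite big_nat_recr //= defect1_prob_rec IH [in RHS]expnS natrM; ring.
Qed.

Lemma Q_defect_prob l n : (0 < l)%N -> Q l p n.+1 = defect_prob n 0.
Proof.
move=> hl; rewrite /Q /defect_prob /expectation big_mkcond /=.
apply: eq_bigr => S _; rewrite decodableE //.
by case: ifP; rewrite ?mulr1 ?mulr0.
Qed.

End Probability.

Theorem theorem8 (R : realFieldType) (l : nat) (hl : (0 < l)%N)
    (p : nat -> R) (hp : forall i : nat, (1 <= i)%N -> 0 <= p i <= 1) :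
  Q l p 1 = p 1%N /\
  forall d : nat, (1 < d)%N ->
    Q l p d = Q l p (d - 1) ^+ 2
      + (2 ^ (d - 1))%N%:R * p d * \prod_(1 <= i < d) ((1 - p i) * Q l p i).
Proof.
split=> [|[|[|n]] // _].
  rewrite Q_defect_prob // /defect_prob expectation_vertex0 /= !inE.
  by rewrite mulr1 mulr0 addr0.
(* Here $d$ is [n.+2], so the exponent $d-1$ is [n.+1]; the product then only needs its index
   shifted by one. *)
rewrite subn1 /= !Q_defect_prob // defect0_prob_rec defect1_prob_closed.
rewrite big_add1 /= mulrA [p _ * _]mulrC; congr (_ + _ * _).
by apply: eq_bigr => i _; rewrite Q_defect_prob.
Qed.
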